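(* Let $q$ be a complex number with $|q|<1$. For any nonnegative integer $n$ we have $$\frac{(-q;q^{2})_{\infty}}{(q^{2};q^{2})_{\infty}}\sum_{j=-n}^{n}(-1)^{j}q^{j(2j+1)}=1+(-1)^{n}(-q;q^{2})_{n+1}\sum_{k=n+1}^{\infty}\frac{(-q;q^{2})_{k-n-1}}{(q^{2};q^{2})_{k}}q^{(n+1)(2k-1)}{k-1 \brack n}_{q^{2}}.$$
   Context: For complex $p$ with $|p|<1$ and complex $z$, $(z;p)_{\infty}:=\prod_{m=0}^{\infty}(1-zp^{m})$. For a nonnegative integer $l$, $(z;p)_{l}:=\frac{(z;p)_{\infty}}{(zp^{l};p)_{\infty}}$, that is, $(z;p)_{l}=\prod_{m=0}^{l-1}(1-zp^{m})$ (with $(z;p)_0=1$). The $p$-binomial coefficient is ${M \brack N}_{p}:=\frac{(p;p)_{M}}{(p;p)_{N}(p;p)_{M-N}}$ if $0\le N\le M$, and $0$ otherwise; here it is used with $p=q^{2}$. *)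

(* Defs.v *)
From HB Require Import structures.
From mathcomp Require Import all_boot all_order all_algebra.
From mathcomp Require Import complex.
From mathcomp Require Import all_classical all_reals all_analysis.

Set Implicit Arguments.
Unset Strict Implicit.
Unset Printing Implicit Defensive.

Import Order.TTheory GRing.Theory Num.Theory numFieldNormedType.Exports.

Local Open Scope ring_scope.

(* The complex numbers R[i] are not given a topology by the library; this is
   the one induced by the modulus, as for every numFieldType. *)
HB.instance Definition _ (R : realType) := NormedModule.copy R[i] R[i]^o.

Section PochhammerSymbols.
Variable K : numFieldType.
Implicit Types (z p : K) (l M N : nat).

(* The product form is used rather than (z;p)_oo / (z p^l;p)_oo, whose
   denominator vanishes when z p^m = 1 for some m >= l. *)
Definition poch z p l : K := \prod_(m < l) (1 - z * p ^+ m).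

Definition poch_inf z p : K := limn (poch z p).

Definition pbinom p M N : K :=
  if (N <= M)%N then poch p p M / (poch p p N * poch p p (M - N)) else 0.

End PochhammerSymbols.

(* Main.v *)
Require Import Defs.
From mathcomp Require Import all_boot all_order all_algebra.
From mathcomp Require Import complex ring zify.
From mathcomp Require Import all_classical all_reals all_analysis.

Import Order.TTheory GRing.Theory Num.Theory numFieldNormedType.Exports.
Import Normc.

Local Open Scope classical_set_scope.
Local Open Scope ring_scope.

(** Write p = q^2, c_m = (-q;p)_m / (p;p)_m and C = lim c_m, the ratio of
    infinite products in the theorem. Let S_n be the product of (-q;p)_(n+1)
    with the sum over k > n, so that the claim is
    C theta_n = 1 + (-1)^n S_n, with theta_n the truncated theta sum. The proof
    is by induction on n.

    For n = 0 the partial sums of 1 + S_0 telescope to c_M ([rest0]).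

    For the induction step, theta_(n+1) - theta_n equals
    (-1)^(n+1) q^((n+1)(2n+1)) (1 + x) with x = p^(n+1) ([thetaS]), so it
    suffices that S_n + S_(n+1) = C q^((n+1)(2n+1)) (1 + x). Adding the two
    series term by term cancels the awkward denominators 1 - p^k
    ([rest_term_pair]) and leaves

      S_n + S_(n+1) = (-q;p)_(n+1) / (p;p)_(n+1) q^((n+1)(2n+1)) (1 - x^2) F(x)

    where F(x) = sum_m c_m x^m. The q-binomial theorem evaluates F(x). Only
    the points x = p^(n+1) occur, and there it follows from the q-difference
    equation (1 - x) F(x) = (1 + q x) F(p x) and the telescoping sum at
    x = p, which give F(p^(n+1)) = C (p;p)_n / (-q;p)_(n+1) ([cvg_qsum]).

    All of this is done on partial sums, so that the only analytic inputs are
    q^m --> 0, the convergence of the infinite products, and the fact that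
    (p;p)_oo does not vanish. *)

(** * Finite identities *)

Lemma poch0 {K : numFieldType} (z p : K) : poch z p 0 = 1.
Proof. by rewrite /poch big_ord0. Qed.

Lemma pochS {K : numFieldType} (z p : K) (l : nat) :
  poch z p l.+1 = poch z p l * (1 - z * p ^+ l).
Proof. by rewrite /poch big_ord_recr. Qed.

(** The coefficients of the basic hypergeometric series
    sum_m (-q;q^2)_m / (q^2;q^2)_m x^m, which the q-binomial theorem sums. *)
Definition qcoef {K : numFieldType} (q : K) (m : nat) : K :=
  poch (- q) (q ^+ 2) m / poch (q ^+ 2) (q ^+ 2) m.

Definition qsum {K : numFieldType} (q x : K) (M : nat) : K :=
  \sum_(m < M) qcoef q m * x ^+ m.

Lemma qcoefS {K : numFieldType} (q : K) (m : nat) :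
  poch (q ^+ 2) (q ^+ 2) m.+1 != 0 ->
  qcoef q m.+1 * (1 - (q ^+ 2) ^+ m.+1) = qcoef q m * (1 + q * (q ^+ 2) ^+ m).
Proof.
rewrite /qcoef !pochS -exprS mulf_eq0 negb_or => /andP[h0 h1].
by field; rewrite h0 h1.
Qed.

(** The q-difference equation (1 - x) F(x) = (1 + q x) F(q^2 x) behind the
    q-binomial theorem, for partial sums. By [qcoefS] the difference of the two
    sides telescopes, and only the last boundary term survives. *)
Lemma qsum_shift {K : numFieldType} (q x : K) (M : nat) :
  (forall m, poch (q ^+ 2) (q ^+ 2) m != 0) ->
  (1 - x) * qsum q x M - (1 + q * x) * qsum q (q ^+ 2 * x) M
  = - (qcoef q M * (1 - (q ^+ 2) ^+ M) * x ^+ M).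
Proof.
move=> hp; elim: M => [|M IH]; first by rewrite /qsum !big_ord0; ring.
move: IH; rewrite /qsum !big_ord_recr /= qcoefS // => IH.
rewrite mulrDr [X in _ - X]mulrDr opprD addrACA IH [(_ * x) ^+ M]exprMn [x ^+ M.+1]exprS; ring.
Qed.

(** At x = q^2 the series telescopes completely. This anchors the
    q-difference equation, so that the q-binomial theorem is only needed at
    the points q^2, q^4, q^6, and so on. *)
Lemma qsum_sqr {K : numFieldType} (q : K) (M : nat) :
  (forall m, poch (q ^+ 2) (q ^+ 2) m != 0) ->
  (1 + q) * qsum q (q ^+ 2) M.+1 = qcoef q M * (1 + q * (q ^+ 2) ^+ M).
Proof.
move=> hp; elim: M => [|M IH].
  by rewrite /qsum big_ord_recr big_ord0 /= !expr0 /qcoef !poch0; field.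
rewrite /qsum big_ord_recr /= mulrDr IH.
rewrite -qcoefS // !exprS; ring.
Qed.

(** The summand of index k = m + n + 1 in the theorem. The q-binomial
    coefficient has been merged with the denominator, and the quotient of
    consecutive (q^2;q^2) is left in place because it is 1 / (1 - q^(2k)). *)
Definition rest_term {K : numFieldType} (q : K) (n m : nat) : K :=
  qcoef q m * (poch (q ^+ 2) (q ^+ 2) (m + n) / poch (q ^+ 2) (q ^+ 2) (m + n).+1)
  / poch (q ^+ 2) (q ^+ 2) n * q ^+ (n.+1 * (m + n).*2.+1).

Definition rest {K : numFieldType} (q : K) (n M : nat) : K :=
  poch (- q) (q ^+ 2) n.+1 * \sum_(m < M) rest_term q n m.

(** The case n = 0 is the telescoping sum of the q-binomial theorem with
    first parameter -1/q at the point q^2, written without dividing by q. *)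
Lemma rest0 {K : numFieldType} (q : K) (M : nat) :
  (forall m, poch (q ^+ 2) (q ^+ 2) m != 0) ->
  1 + rest q 0 M = qcoef q M.
Proof.
move=> hp; rewrite /rest pochS poch0 mul1r expr0 mulr1 opprK.
elim: M => [|M IH]; first by rewrite big_ord0 /qcoef !poch0 mulr0 addr0 invr1 mulr1.
rewrite big_ord_recr /= mulrDr addrA IH.
have h0 := hp M; have h1 := hp M.+1.
have -> : rest_term q 0 M = qcoef q M / (1 - (q ^+ 2) ^+ M.+1) * q ^+ M.*2.+1.
  rewrite /rest_term addn0 poch0 mul1n.
  move: h1; rewrite pochS -exprS mulf_eq0 negb_or => /andP[_ h1].
  by field; rewrite h0 h1.
move: (h1); rewrite pochS -exprS mulf_eq0 negb_or => /andP[_ h2].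
have -> : q ^+ M.*2.+1 = q * (q ^+ 2) ^+ M by rewrite exprS -mul2n exprM.
apply: (mulIf h2); rewrite qcoefS //; move: h2; rewrite exprS => h2.
by field.
Qed.

(** The key cancellation. The summands for n and n + 1 with the same k share
    the factor 1 / (1 - q^(2k)), and the numerator of their weighted sum is
    divisible by 1 - q^(2k). What remains has no denominator mixing m and n:
    it is a combination of consecutive terms of [qsum] at x = q^(2(n+1)). *)
Lemma rest_term_pair {K : numFieldType} (q : K) (n m : nat) :
  (forall m, poch (q ^+ 2) (q ^+ 2) m != 0) ->
  let x := (q ^+ 2) ^+ n.+1 in
  rest_term q n m.+1 + (1 + q * x) * rest_term q n.+1 m
  = q ^+ (n.+1 * n.*2.+1) / poch (q ^+ 2) (q ^+ 2) n.+1
    * (qcoef q m.+1 * x ^+ m.+1 - x ^+ 2 * (qcoef q m * x ^+ m)).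
Proof.
move=> hp; set x := (q ^+ 2) ^+ n.+1.
have hx k : 1 - (q ^+ 2) ^+ k.+1 != 0.
  by have := hp k.+1; rewrite pochS -exprS mulf_eq0 negb_or => /andP[_].
have hn := hp n.
have hm := hp (m + n).+1.
have E0 : 1 - (q ^+ 2) ^+ (m + n).+2 = 1 - x * q ^+ 2 * (q ^+ 2) ^+ m.
  by rewrite /x -!exprM -!exprD; congr (1 - _ ^+ _); lia.
have hmn := hx (m + n).+1; rewrite E0 in hmn.
have E1 : q ^+ (n.+1 * (m + n).+1.*2.+1) = q ^+ (n.+1 * n.*2.+1) * x ^+ m.+1.
  by rewrite /x -!exprM -exprD; congr (_ ^+ _); lia.
have E2 : q ^+ (n.+2 * (m + n).+1.*2.+1)
          = q ^+ (n.+1 * n.*2.+1) * x ^+ m.+1 * (q * x * (q ^+ 2) ^+ m).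
  by rewrite /x -!exprM -!exprS -!exprD; congr (_ ^+ _); lia.
rewrite /rest_term addSn addnS E1 E2 [poch _ _ (m + n).+2]pochS [poch _ _ n.+1]pochS -!exprS E0 -/x.
have hx' : 1 - x != 0 by exact: hx.
have -> : qcoef q m.+1 = qcoef q m * (1 + q * (q ^+ 2) ^+ m) / (1 - (q ^+ 2) ^+ m.+1).
  by rewrite -qcoefS // mulfK.
have hy := hx m; rewrite [(q ^+ 2) ^+ m.+1]exprS in hy *.
rewrite [x ^+ m.+1]exprS.
move: (x ^+ m) (q ^+ (n.+1 * _)) (qcoef q m) ((q ^+ 2) ^+ m) hm hn hx' hmn hy.
clear hp hx E0 E1 E2; clearbody x.
move: (poch _ _ _) (poch _ _ _) x => A B x X e c P hA hB h1 h2 h3.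
by field; do ?[apply/andP; split].
Qed.

(** Summation of [rest_term_pair]; the term k = n + 1, which occurs for n
    only, supplies the constant term of the first [qsum]. *)
Lemma rest_pair {K : numFieldType} (q : K) (n M : nat) :
  (forall m, poch (q ^+ 2) (q ^+ 2) m != 0) ->
  let x := (q ^+ 2) ^+ n.+1 in
  rest q n M.+1 + rest q n.+1 M
  = poch (- q) (q ^+ 2) n.+1 / poch (q ^+ 2) (q ^+ 2) n.+1 * q ^+ (n.+1 * n.*2.+1)
    * (qsum q x M.+1 - x ^+ 2 * qsum q x M).
Proof.
move=> hp x; rewrite /rest /qsum [poch _ _ n.+2]pochS mulNr opprK -mulrA -mulrDr.
rewrite -[RHS]mulrA -[RHS]mulrA; congr (_ * _); rewrite !big_ord_recl /= -!addrA.
have -> : rest_term q n 0 = (poch (q ^+ 2) (q ^+ 2) n.+1)^-1 * q ^+ (n.+1 * n.*2.+1).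
  rewrite /rest_term add0n /qcoef !poch0; have h0 := hp n; have h1 := hp n.+1.
  by field; rewrite h0 h1.
rewrite [qcoef q 0]/qcoef !poch0 invr1 !mulr1 !mulrA mulrDr mulr1; congr (_ + _).
rewrite !mulr_sumr -!sumrB -big_split /= mulr_sumr; apply: eq_bigr => i _.
by rewrite rest_term_pair // [in RHS]mulrC -/x; ring.
Qed.

Definition theta {K : numFieldType} (q : K) (n : nat) : K :=
  \sum_(i < 2 * n + 1)
    let j : int := (i : nat)%:Z - n%:Z in (-1) ^ j * q ^ (j * (2 * j + 1)).

Lemma theta0 {K : numFieldType} (q : K) : theta q 0 = 1.
Proof. by rewrite /theta big_ord_recl big_ord0 /= subrr mul0r !expr0z mulr1 addr0. Qed.

Lemma thetaS {K : numFieldType} (q : K) (n : nat) :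
  theta q n.+1 = theta q n
    + (-1) ^+ n.+1 * (q ^+ (n.+1 * n.*2.+1) * (1 + (q ^+ 2) ^+ n.+1)).
Proof.
rewrite /theta (_ : (2 * n.+1 + 1 = (2 * n + 1).+2)%N); last by lia.
rewrite big_ord_recl big_ord_recr /= addrCA; congr (_ + _).
  apply: eq_bigr => i _.
  by rewrite /bump /= (_ : (1 + i)%:Z - n.+1%:Z = i%:Z - n%:Z); last by lia.
have -> : (0%:Z - n.+1%:Z) = - n.+1%:Z by lia.
have -> : (bump 0 (2 * n + 1))%:Z - n.+1%:Z = n.+1%:Z by rewrite /bump /=; lia.
have -> : - n.+1%:Z * (2 * - n.+1%:Z + 1) = (n.+1 * n.*2.+1)%N%:Z by lia.
have -> : n.+1%:Z * (2 * n.+1%:Z + 1) = (n.+1 * n.*2.+1 + 2 * n.+1)%N%:Z by lia.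
rewrite -exprnN -!exprnP invr_sign exprD [q ^+ (2 * _)]exprM; ring.
Qed.

(** * The limits of the partial sums *)

(** The q-binomial theorem at x = q^(2(n+1)): the infinite products
    (-q x;q^2) and (x;q^2) are expressed by finite ones and by the limit C of
    the coefficients, which turns out to be the ratio of the products in the
    theorem. *)
Lemma cvg_qsum {K : numFieldType} (q C : K) (n : nat) :
  (forall m, poch (q ^+ 2) (q ^+ 2) m != 0) ->
  (forall m, poch (- q) (q ^+ 2) m != 0) ->
  (q ^+ m @[m --> \oo] --> (0 : K)) -> (qcoef q m @[m --> \oo] --> C) ->
  qsum q ((q ^+ 2) ^+ n.+1) M @[M --> \oo]
    --> C * (poch (q ^+ 2) (q ^+ 2) n / poch (- q) (q ^+ 2) n.+1).
Proof.
move=> hp ha hq hC.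
have hp0 : (q ^+ 2) ^+ m @[m --> \oo] --> (0 : K).
  rewrite -[X in _ --> X](mul0r (0 : K)).
  by under eq_fun do rewrite -exprM mulnC exprM expr2; exact: cvgM.
have hx m : 1 + q * (q ^+ 2) ^+ m != 0.
  by have := ha m.+1; rewrite pochS mulf_eq0 negb_or mulNr opprK => /andP[].
elim: n => [|n IH].
  rewrite expr1 pochS !poch0 expr0 mulr1 opprK !mul1r.
  rewrite -(cvg_shiftS (qsum q (q ^+ 2))).
  have -> : [sequence qsum q (q ^+ 2) M.+1]_M =
    (fun M => qcoef q M * (1 + q * (q ^+ 2) ^+ M) * (1 + q)^-1).
    apply/funext => M /=; have := hx 0; rewrite expr0 mulr1 => h.
    by rewrite -qsum_sqr // mulrC mulKf.
  rewrite (_ : C / (1 + q) = C * (1 + q * 0) / (1 + q)); last by rewrite mulr0 addr0 mulr1.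
  apply: cvgM; last exact: cvg_cst.
  apply: cvgM => //; apply: cvgD; first exact: cvg_cst.
  by apply: cvgM => //; exact: cvg_cst.
set x := (q ^+ 2) ^+ n.+1 in IH *.
have hx' : 1 + q * x != 0 by exact: hx.
have -> : qsum q ((q ^+ 2) ^+ n.+2) = fun M =>
    ((1 - x) * qsum q x M + qcoef q M * (1 - (q ^+ 2) ^+ M) * x ^+ M) / (1 + q * x).
  apply/funext => M; rewrite exprS -/x; apply: (mulIf hx'); rewrite mulfVK //.
  rewrite -[qcoef q M * _ * _]opprK -qsum_shift //; ring.
have -> : C * (poch (q ^+ 2) (q ^+ 2) n.+1 / poch (- q) (q ^+ 2) n.+2) =
   ((1 - x) * (C * (poch (q ^+ 2) (q ^+ 2) n / poch (- q) (q ^+ 2) n.+1))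
     + C * (1 - 0) * 0) / (1 + q * x).
  rewrite pochS [poch _ _ n.+2]pochS -exprS -/x mulNr opprK.
  by field; rewrite hx' ha.
apply: cvgM; last exact: cvg_cst.
apply: cvgD; first by apply: cvgM => //; exact: cvg_cst.
apply: cvgM; first by apply: cvgM => //; apply: cvgB => //; exact: cvg_cst.
have -> : GRing.exp x = (fun M => (q ^+ 2) ^+ M * ((q ^+ 2) ^+ M) ^+ n).
  by apply/funext => M; rewrite -exprS -exprM mulnC exprM.
elim: {1}n => [|k IHk].
  by under eq_fun do rewrite expr0 mulr1.
rewrite -[X in _ --> X](mul0r (0 : K)).
by under eq_fun do rewrite [_ ^+ k.+1]exprSr mulrA; exact: cvgM.
Qed.

(** Induction on n: the limits of [rest q n] and [rest q n.+1] add up to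
    what [rest_pair] and [cvg_qsum] give, namely C q^((n+1)(2n+1)) times
    1 + q^(2(n+1)). Up to sign this is C times the two terms j = n + 1 and
    j = - (n + 1) by which the theta sum grows. *)
Lemma cvg_rest {K : numFieldType} (q C : K) (n : nat) :
  (forall m, poch (q ^+ 2) (q ^+ 2) m != 0) ->
  (forall m, poch (- q) (q ^+ 2) m != 0) ->
  (q ^+ m @[m --> \oo] --> (0 : K)) -> (qcoef q m @[m --> \oo] --> C) ->
  rest q n M @[M --> \oo] --> (-1) ^+ n * (C * theta q n - 1).
Proof.
move=> hp ha hq hC; elim: n => [|n IH].
  rewrite theta0 expr0 mul1r mulr1.
  have -> : rest q 0 = fun M => qcoef q M - 1.
    by apply/funext => M; rewrite -rest0 // addrC addKr.
  by apply: cvgB => //; exact: cvg_cst.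
have := cvg_qsum q C n hp ha hq hC; set x := _ ^+ n.+1 => hF.
have -> : rest q n.+1 = fun M =>
   poch (- q) (q ^+ 2) n.+1 / poch (q ^+ 2) (q ^+ 2) n.+1 * q ^+ (n.+1 * n.*2.+1)
    * (qsum q x M.+1 - x ^+ 2 * qsum q x M) - rest q n M.+1.
  by apply/funext => M; rewrite -rest_pair // addrC addKr.
set F := C * (_ / _) in hF.
have -> : (-1) ^+ n.+1 * (C * theta q n.+1 - 1) =
   poch (- q) (q ^+ 2) n.+1 / poch (q ^+ 2) (q ^+ 2) n.+1 * q ^+ (n.+1 * n.*2.+1)
    * (F - x ^+ 2 * F) - (-1) ^+ n * (C * theta q n - 1).
  rewrite thetaS -/x /F.
  rewrite [poch (q ^+ 2) _ n.+1]pochS -exprS -/x.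
  have := hp n.+1; rewrite pochS -exprS mulf_eq0 negb_or -/x => /andP[h1 h2].
  have h3 := ha n.+1.
  have h4 : (-1) ^+ n.+1 * (-1) ^+ n.+1 = 1 :> K by rewrite -expr2 sqrr_sign.
  rewrite mulrBr mulrDr [(-1) ^+ n.+1 * (_ + _)]mulrDr.
  rewrite (_ : (-1) ^+ n.+1 * (C * ((-1) ^+ n.+1 * (q ^+ (n.+1 * n.*2.+1) * (1 + x)))) =
     C * (q ^+ (n.+1 * n.*2.+1) * (1 + x))); last by rewrite mulrCA [(-1) ^+ _ * (_ * _)]mulrA h4 mul1r.
  rewrite exprS; move: (q ^+ (_ * _)) => e.
  by field; rewrite ?h1 ?h2 ?h3.
have sh (u : nat -> K) l : u m @[m --> \oo] --> l -> u m.+1 @[m --> \oo] --> l.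
  by move=> ?; rewrite (cvg_shiftS u).
apply: cvgB; last exact: sh.
apply: cvgM; first exact: cvg_cst.
by apply: cvgB; [exact: sh|apply: cvgM => //; exact: cvg_cst].
Qed.

Lemma cvg_rest_term_series {K : numFieldType} (q C : K) (n : nat) :
  (forall m, poch (q ^+ 2) (q ^+ 2) m != 0) ->
  (forall m, poch (- q) (q ^+ 2) m != 0) ->
  (q ^+ m @[m --> \oo] --> (0 : K)) -> (qcoef q m @[m --> \oo] --> C) ->
  \sum_(m < M) rest_term q n m @[M --> \oo]
    --> (-1) ^+ n * (C * theta q n - 1) / poch (- q) (q ^+ 2) n.+1.
Proof.
move=> hp ha hq hC.
have -> : (fun M => \sum_(m < M) rest_term q n m) =
          fun M => rest q n M / poch (- q) (q ^+ 2) n.+1.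
  by apply/funext => M; rewrite /rest mulrAC divff // mul1r.
apply: cvgM; [exact: cvg_rest|exact: cvg_cst].
Qed.

(** * Infinite products of complex numbers *)

Lemma norm_normc (R : rcfType) (z : R[i]) : `|z| = (normc z)%:C%C.
Proof. by []. Qed.

Lemma normc_ge0 (R : rcfType) (z : R[i]) : 0 <= normc z.
Proof. by rewrite -ler0c -norm_normc. Qed.

Lemma normcX (R : rcfType) (z : R[i]) (m : nat) : normc (z ^+ m) = normc z ^+ m.
Proof.
by elim: m => [|m IH]; rewrite ?expr0 ?normc1 // !exprS normcM IH.
Qed.

Lemma cvg_normc (R : realType) (u : nat -> R[i]) (l : R[i]) :
  normc (l - u n) @[n --> \oo] --> (0 : R) -> u n @[n --> \oo] --> l.
Proof.
move=> h; apply/cvgrPdist_lt => e e0.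
(* The order on R[i] makes a positive e real. *)
have Ee : e = (complex.Re e)%:C%C by rewrite -(ger0_norm (ltW e0)) norm_normc.
have e0' : 0 < complex.Re e by rewrite -ltcR -Ee.
move/cvgrPdist_lt: h => /(_ _ e0'); apply: filterS => n.
rewrite sub0r normrN norm_normc [in X in _ -> X]Ee ltcR; exact/le_lt_trans/ler_norm.
Qed.

Lemma cvg_expn (R : realType) (q : R[i]) : `|q| < 1 -> q ^+ m @[m --> \oo] --> (0 : R[i]).
Proof.
move=> hq; apply: cvg_normc.
under eq_fun do rewrite sub0r normcN normcX.
have h : `|normc q| < 1 by rewrite ger0_norm ?normc_ge0 // -ltcR -norm_normc.
exact: cvg_expr.
Qed.

Lemma cvg_complex (R : realType) (u : nat -> R[i]) (a b : R) :
  complex.Re (u n) @[n --> \oo] --> a -> complex.Im (u n) @[n --> \oo] --> b ->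
  u n @[n --> \oo] --> (a +i* b)%C.
Proof.
move=> ha hb; apply: cvg_normc.
have h : `|a - complex.Re (u n)| + `|b - complex.Im (u n)| @[n --> \oo] --> (0 : R).
  rewrite -[X in _ --> X]addr0; apply: cvgD; rewrite -(normr0 R); apply: cvg_norm.
    by rewrite -(subrr a); apply: cvgB => //; exact: cvg_cst.
  by rewrite -(subrr b); apply: cvgB => //; exact: cvg_cst.
apply: (squeeze_cvgr _ (cvg_cst 0) h); apply: nearW => n; apply/andP; split.
  by rewrite normc_ge0.
case: (u n) => x y.
have -> : (a +i* b - x +i* y)%C = ((a - x) +i* 0 + 0 +i* (b - y))%C.
  by apply/eqP; rewrite eq_complex /= addr0 add0r !eqxx.
apply: le_trans (le_normcD _ _) _.
by rewrite /= expr0n /= addr0 add0r !sqrtr_sqr.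
Qed.

Lemma normc_ge_absRe (R : realType) (z : R[i]) : `|complex.Re z| <= normc z.
Proof. by rewrite -lecR; exact: normc_ge_Re. Qed.

Lemma normc_ge_absIm (R : realType) (z : R[i]) : `|complex.Im z| <= normc z.
Proof. by case: z => x y /=; rewrite -sqrtr_sqr ler_sqrt ?addr_ge0 ?sqr_ge0 // lerDr sqr_ge0. Qed.

Lemma cvgn_increments (R : realType) (u : nat -> R) (M r : R) :
  0 <= r < 1 -> (forall n, `|u n.+1 - u n| <= M * r ^+ n) -> cvgn u.
Proof.
move=> /andP[r0 r1] hu.
pose v n := u n.+1 - u n.
have cv : cvgn (series v).
  apply: normed_cvg; apply: (@series_le_cvg _ _ (geometric M r)) => //=.
  - by move=> n; exact: le_trans (hu n).
  - by apply: is_cvg_geometric_series; rewrite ger0_norm.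
have -> : u = fun n => u 0 + series v n.
  apply/funext => n; rewrite /series /= /v.
  by rewrite telescope_sumr // addrC subrK.
by apply: is_cvgD => //; exact: is_cvg_cst.
Qed.

(** Completeness of the complex numbers is inherited from that of the reals
    through real and imaginary parts. *)
Lemma cvgn_complex_increments (R : realType) (u : nat -> R[i]) (M r : R) :
  0 <= r < 1 -> (forall n, normc (u n.+1 - u n) <= M * r ^+ n) -> cvgn u.
Proof.
move=> hr hu.
have reB (z w : R[i]) : complex.Re (z - w) = complex.Re z - complex.Re w by case: z; case: w.
have imB (z w : R[i]) : complex.Im (z - w) = complex.Im z - complex.Im w by case: z; case: w.
have /cvg_ex[a ha] : cvgn (fun n => complex.Re (u n)).
  by apply: (@cvgn_increments R (fun n => complex.Re (u n)) M r hr) => n; rewrite /= -reB; apply: le_trans (hu n); exact: normc_ge_absRe.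
have /cvg_ex[b hb] : cvgn (fun n => complex.Im (u n)).
  by apply: (@cvgn_increments R (fun n => complex.Im (u n)) M r hr) => n; rewrite /= -imB; apply: le_trans (hu n); exact: normc_ge_absIm.
by apply/cvg_ex; exists (a +i* b)%C; exact: cvg_complex.
Qed.

(** The partial products are bounded by exp (sum_m |u_m|), so that their
    increments are dominated by a geometric sequence. *)
Lemma cvgn_prod (R : realType) (u : nat -> R[i]) (K r : R) :
  0 <= r < 1 -> (forall m, normc (u m) <= K * r ^+ m) ->
  cvgn (fun N => \prod_(m < N) (1 + u m)).
Proof.
move=> hr hu; have /andP[r0 r1] := hr.
have K0 : 0 <= K by have := hu 0; rewrite expr0 mulr1; apply: le_trans; rewrite normc_ge0.
have bnd N : normc (\prod_(m < N) (1 + u m)) <= expR (K / (1 - r)).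
  apply: (@le_trans _ _ (expR (\sum_(m < N) K * r ^+ m))).
    elim: N => [|N IH]; first by rewrite !big_ord0 normc1 expR0.
    rewrite !big_ord_recr /= normcM expRD; apply: ler_pM => //; rewrite ?normc_ge0 //.
    apply: le_trans (le_normcD _ _) _; rewrite normc1.
    by apply: le_trans (expR_ge1Dx _); rewrite lerD2l.
  rewrite ler_expR -mulr_sumr ler_wpM2l //.
  have h1 : 0 < 1 - r by rewrite subr_gt0.
  rewrite -(ler_pM2r h1) mulVf ?gt_eqF // mulrC -opprB mulNr -subrX1 opprB.
  by rewrite lerBlDr lerDl exprn_ge0.
apply: (@cvgn_complex_increments _ _ (expR (K / (1 - r)) * K) r) => // n.
rewrite big_ord_recr /= mulrDr mulr1 addrC addKr normcM -mulrA.
by apply: ler_pM; [exact: normc_ge0|exact: normc_ge0|exact: bnd|exact: hu].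
Qed.

Lemma subr1_neq0 {K : numFieldType} (z : K) : `|z| < 1 -> 1 - z != 0.
Proof. by move=> h; rewrite subr_eq0 eq_sym; apply: contraTneq h => ->; rewrite normr1 ltxx. Qed.

Lemma poch_neq0 {K : numFieldType} (z p : K) (m : nat) :
  `|z| < 1 -> `|p| < 1 -> poch z p m != 0.
Proof.
move=> hz hp; apply/prodf_neq0 => i _; apply: subr1_neq0.
rewrite normrM normrX; apply: le_lt_trans hz.
by rewrite ler_piMr // exprn_ile1 // ltW.
Qed.

Lemma cvgn_poch (R : realType) (z p : R[i]) : `|p| < 1 -> cvgn (poch z p).
Proof.
rewrite norm_normc -[1]/(1%:C)%C ltcR => hp.
have -> : poch z p = fun N => \prod_(m < N) (1 + - (z * p ^+ m)) by [].
apply: (@cvgn_prod R (fun m => - (z * p ^+ m)) (normc z) (normc p)) => [|m].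
  by rewrite normc_ge0.
by rewrite normcN normcM normcX.
Qed.

Lemma cvg_inverse_neq0 {K : numFieldType} (f g : nat -> K) (a b : K) :
  f m @[m --> \oo] --> a -> g m @[m --> \oo] --> b ->
  (forall m, f m * g m = 1) -> a != 0.
Proof.
move=> ha hb h; apply/eqP => a0.
have h0 : (fun=> 1) @ \oo --> (0 : K).
  have <- : (fun m => f m * g m) = fun=> 1 by apply/funext => m; exact: h.
  by rewrite -(mul0r b) -a0; exact: cvgM.
have := oner_neq0 K; rewrite -(cvg_lim _ h0) ?lim_cst ?eqxx //; exact: norm_hausdorff.
Qed.

(** The reciprocals of the factors are 1 + u_m with u_m again geometrically
    small, so the reciprocals of the partial products converge too. *)
Lemma poch_inf_neq0 (R : realType) (p : R[i]) : `|p| < 1 -> poch_inf p p != 0.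
Proof.
move=> hp; have := hp; rewrite norm_normc -[1]/(1%:C)%C ltcR => hp1.
have hr : 0 <= normc p < 1 by rewrite normc_ge0.
have hX m : `|p ^+ m.+1| < 1 by rewrite normrX exprn_ilt1.
pose u m := p ^+ m.+1 / (1 - p ^+ m.+1).
have hu m : normc (u m) <= (1 - normc p)^-1 * normc p ^+ m.
  rewrite normcM normcX normcV mulrC; apply: ler_pM.
  - by rewrite invr_ge0 normc_ge0.
  - by rewrite exprn_ge0 // normc_ge0.
  (* |1 - p^(m+1)| >= 1 - |p| by the triangle inequality. *)
  - rewrite lef_pV2 ?posrE ?subr_gt0 //; last first.
      by rewrite lt_neqAle normc_ge0 andbT eq_sym; apply: contra (subr1_neq0 _ (hX m)) => /eqP/eq0_normc->.
    have := le_normcD (1 - p ^+ m.+1) (p ^+ m.+1); rewrite subrK normc1 normcX.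
    rewrite lerBlDr => /le_trans; apply; rewrite lerD2l exprS ler_piMr ?normc_ge0 //.
    by rewrite exprn_ile1 ?normc_ge0 // ltW.
  - by rewrite exprS ler_piMl ?exprn_ge0 ?normc_ge0 // ltW.
have /cvg_ex[P' hP'] := cvgn_prod _ _ _ _ hr hu.
have hP : poch p p m @[m --> \oo] --> poch_inf p p := cvgn_poch _ p p hp.
apply: (@cvg_inverse_neq0 (R[i] : numFieldType) _ _ _ _ hP hP') => N.
rewrite /poch -big_split /= big1 // => i _.
rewrite -exprS /u; field; exact: subr1_neq0.
Qed.

(** * The truncated theta identity *)

Theorem theorem1p3 (R : realType) (q : R[i]) (hq : `|q| < 1) (n : nat) :
  let a := fun k : nat =>
    poch (- q) (q ^+ 2) (k - n - 1) / poch (q ^+ 2) (q ^+ 2) k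
      * q ^+ ((n + 1) * (2 * k - 1)) * pbinom (q ^+ 2) (k - 1) n in
  cvgn (fun N : nat => \sum_(n + 1 <= k < N) a k) /\
  poch_inf (- q) (q ^+ 2) / poch_inf (q ^+ 2) (q ^+ 2)
    * (\sum_(i < 2 * n + 1)
         let j : int := (i : nat)%:Z - n%:Z in (-1) ^ j * q ^ (j * (2 * j + 1)))
  = 1 + (-1) ^+ n * poch (- q) (q ^+ 2) (n + 1)
        * \big[+%R/0]_(n + 1 <= k <oo) a k.
Proof.
move=> a.
have hp : `|q ^+ 2| < 1 by rewrite normrX exprn_ilt1.
have hP m : poch (q ^+ 2) (q ^+ 2) m != 0 by exact: poch_neq0.
have hA m : poch (- q) (q ^+ 2) m != 0 by apply: poch_neq0; rewrite ?normrN.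
set C := _ / _; rewrite -/(theta q n).
have hC : qcoef q m @[m --> \oo] --> C.
  apply: cvgM; first exact: (cvgn_poch _ (- q) _ hp).
  by apply: cvgV; [exact: poch_inf_neq0|exact: (cvgn_poch _ (q ^+ 2) _ hp)].
have hT := cvg_rest_term_series q C n hP hA (cvg_expn _ _ hq) hC.
have aE m : a (m + n.+1)%N = rest_term q n m.
  rewrite /a /pbinom !addn1 (_ : (m + n.+1 - n - 1 = m)%N); last by lia.
  rewrite (_ : (m + n.+1 - 1 = m + n)%N) ?leq_addl; last by lia.
  rewrite addnK (_ : (2 * (m + n.+1) - 1 = (m + n).*2.+1)%N) ?addnS; last by lia.
  rewrite /rest_term /qcoef; move: (hP (m + n).+1) (hP m) (hP n) => h1 h2 h3.
  by field; rewrite h1 h2 h3.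
have hS : \sum_(n + 1 <= k < N) a k @[N --> \oo] -->
    (-1) ^+ n * (C * theta q n - 1) / poch (- q) (q ^+ 2) n.+1.
  rewrite -(cvg_shiftn n.+1 (fun N => \sum_(n + 1 <= k < N) a k)).
  have -> : [sequence \sum_(n + 1 <= k < N + n.+1) a k]_N =
     fun M => \sum_(m < M) rest_term q n m.
    apply/funext => M /=; rewrite addn1 -{1}[n.+1]add0n big_addn addnK big_mkord.
    by apply: eq_bigr => i _; rewrite aE.
  exact: hT.
split; first by apply/cvg_ex; eexists; exact: hS.
rewrite (cvg_lim _ hS); last exact: norm_hausdorff.
rewrite addn1 mulrACA divff // mulr1 mulrA -expr2 sqrr_sign mul1r.
by rewrite addrC subrK.
Qed.
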